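(* Let $1\le s\le n$ and let $f_1(X)=0,\dots,f_s(X)=0$ be $s$ algebraic hypersurfaces without multiple factors in $\mathbb{C}^n$, of degrees $k_1,\dots,k_s$ respectively, which sufficiently intersect at the algebraic manifold $S_{n-s}=s(f_1,\dots,f_s)$. Put $S_{n-s+1}=s(f_1,\dots,f_{s-1})$. Let $E_{S_{n-s}}^{(m)}$ be a set of $e_m^{(n)}(k_1,\dots,k_s)$ distinct points on $S_{n-s}$ which is a properly posed set of nodes (PPSN) for Lagrange interpolation of degree $m$ along $S_{n-s}$, and let $E_{S_{n-s+1}}^{(m-k_s)}$ be a set of $e_{m-k_s}^{(n)}(k_1,\dots,k_{s-1})$ distinct points on $S_{n-s+1}$ which is a PPSN for Lagrange interpolation of degree $m-k_s$ along $S_{n-s+1}$. Suppose that the hypersurface $f_s(X)=0$ does not contain any point of $E_{S_{n-s+1}}^{(m-k_s)}$. Then $E_{S_{n-s}}^{(m)}\cup E_{S_{n-s+1}}^{(m-k_s)}$ is a PPSN for Lagrange interpolation of degree $m$ along $S_{n-s+1}$.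
   Context: $X=(x_1,\dots,x_n)$. $\mathbb{P}_m^{(n)}$ is the complex vector space of polynomials in $\mathbb{C}[x_1,\dots,x_n]$ of total degree $\le m$ ($\mathbb{P}_m^{(n)}=\{0\}$ for $m<0$). $s(f_1,\dots,f_s)$ is the set of common zeros of $f_1,\dots,f_s$ in $\mathbb{C}^n$. A hypersurface $f(X)=0$ is without multiple factors if $f$ has no repeated non-constant factor. Sufficient intersection: hypersurfaces $f_1=0,\dots,f_s=0$ of degrees $k_1,\dots,k_s$ in $\mathbb{C}^n$ ($1\le s\le n$) sufficiently intersect at $S=s(f_1,\dots,f_s)$ if there exist $n-s$ hypersurfaces $f_{s+1}=0,\dots,f_n=0$ of degrees $k_{s+1},\dots,k_n$ such that $f_1=0,\dots,f_n=0$ meet exactly at $k_1\cdots k_n$ mutually distinct points of $\mathbb{C}^n$. For every integer $m$, $e_m^{(n)}=\binom{m+n}{n}$, with $e_m^{(n)}=0$ for $m<0$. With $\nabla_k u_m=u_m-u_{m-k}$, put $e_m^{(n)}(k_1,\dots,k_s)=\nabla_{k_s}\cdots\nabla_{k_1}e_m^{(n)}$ (for $s=0$ this is $e_m^{(n)}$). PPSN: a set $\mathcal{A}=\{Q^{(i)}\}$ of exactly $e_m^{(n)}(k_1,\dots,k_s)$ distinct points on $S=s(f_1,\dots,f_s)$ is a PPSN for Lagrange interpolation of degree $m$ along $S$ if for every set of complex numbers $\{q_i\}_{i=1}^{e_m^{(n)}(k_1,\dots,k_s)}$ there exists $f\in\mathbb{P}_m^{(n)}$ with $f(Q^{(i)})=q_i$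 for all $i$. For $s=0$, $S=\mathbb{C}^n$ and a PPSN of degree $m$ along $S$ means a PPSN for $\mathbb{P}_m^{(n)}$, i.e. a set of $e_m^{(n)}$ distinct points of $\mathbb{C}^n$ on which every set of data is interpolated by a unique polynomial in $\mathbb{P}_m^{(n)}$. For negative degree the PPSN is the empty set. *)

(* Defs.v *)
From mathcomp Require Import all_boot all_order all_algebra.
From mathcomp Require Import finmap mpoly complex reals.

Set Implicit Arguments.
Unset Strict Implicit.
Unset Printing Implicit Defensive.

Import GRing.Theory.

Local Open Scope ring_scope.

(* Affine space K^n; [f.@[x]] evaluates [f : {mpoly K[n]}] at such an [x]. *)
Notation point K n := {ffun 'I_n -> K}.

Section Defs.

Variables (K : fieldType) (n : nat).

Implicit Types (f g : {mpoly K[n]}) (fs : seq {mpoly K[n]}) (ks : seq nat).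

(* [msize f] is one more than the total degree, and [msize 0 = 0]. *)
Definition degree_le (m : int) f : bool :=
  match m with
  | Posz d => (msize f <= d.+1)%N
  | Negz _ => f == 0
  end.

(* A hypersurface is given by a non-constant polynomial: if degree 0 were
   allowed, [sufficiently_intersect] could be met by an auxiliary constant. *)
Definition hypersurface f (k : nat) : bool :=
  (0 < k)%N && (msize f == k.+1).

Definition without_multiple_factors f : Prop :=
  forall g h, f = g ^+ 2 * h -> (msize g <= 1)%N.

(* For [fs = [::]] this is the whole of K^n. *)
Definition common_zero fs (x : point K n) : Prop :=
  forall f, f \in fs -> f.@[x] = 0.

Definition sufficiently_intersect fs ks : Prop :=
  exists (gs : seq {mpoly K[n]}) (ls : seq nat),
    [/\ size (fs ++ gs) = n,
        all2 hypersurface (fs ++ gs) (ks ++ ls) &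
        exists Z : {fset point K n},
          #|` Z| = (\prod_(k <- ks ++ ls) k)%N /\
          (forall x, x \in Z <-> common_zero (fs ++ gs) x)].

Definition nabla (k : nat) (u : int -> int) (m : int) : int :=
  u m - u (m - k%:Z).

Definition binom_e (m : int) : int :=
  match m with
  | Posz d => 'C(d + n, n)%:Z
  | Negz _ => 0
  end.

(* [e_along [:: k_1; ...; k_s] m = nabla k_s (... (nabla k_1 binom_e)) m] *)
Definition e_along ks : int -> int :=
  foldl (fun u k => nabla k u) binom_e ks.

Definition interpolates (m : int) (E : {fset point K n}) (q : point K n -> K) f
    : Prop :=
  degree_le m f /\ (forall x, x \in E -> f.@[x] = q x).

(* Uniqueness of the interpolant is part of the notion only when S = K^n;
   otherwise interpolants differ by polynomials vanishing on S. *)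
Definition PPSN fs ks (m : int) (E : {fset point K n}) : Prop :=
  [/\ (#|` E|)%:Z = e_along ks m,
      (forall x, x \in E -> common_zero fs x) &
      forall q : point K n -> K,
        if fs is [::] then exists! f, interpolates m E q f
        else exists f, interpolates m E q f].

End Defs.

(* Main.v *)
Require Import Defs.
From mathcomp Require Import all_boot all_order all_algebra.
From mathcomp Require Import finmap mpoly complex reals.

(** Write g for the last hypersurface and fs for the others, and let k be the
    degree of g.  The two node sets are interpolated one after the other.
    Choose p of degree at most m with the prescribed values on E1, which lies
    on g = 0.  Since g does not vanish on E2, some r of degree at most m - k
    takes the value (q - p) / g at each point of E2.  Then p + r * g has degree
    at most m, still agrees with p on E1, and has the right values on E2
    (lemma [interpolates_fsetU]).

    The same non-vanishing makes E1 and E2 disjoint, so the union has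
    e_m(ks, k) + e_(m-k)(ks) points.  This is e_m(ks), because
    e_m(ks, k) = e_m(ks) - e_(m-k)(ks) by definition of nabla.

    When fs is empty, properly posed means in addition that the interpolant is
    unique.  The number of nodes is then 'C(m + n, n), the dimension of the
    space of polynomials of degree at most m (lemma [card_bmultinom]), so the
    evaluation map at the nodes, being onto, is also one-to-one (lemma
    [interpolates_unique]). *)

Set Implicit Arguments.
Unset Strict Implicit.
Unset Printing Implicit Defensive.

Import GRing.Theory.

Local Open Scope ring_scope.
Local Open Scope fset_scope.

(** The monomials of degree at most d in n variables correspond to the n-tuples
    over {0, ..., d} with sum at most d, counted by
    [card_partial_ord_partitions]; truncating the exponents to 'I_d.+1 loses
    nothing, as each of them is at most the degree. *)
Lemma card_bmultinom (n d : nat) : #|{: 'X_{1..n < d.+1}}| = 'C(d + n, n).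
Proof.
pose F (b : 'X_{1..n < d.+1}) : n.-tuple 'I_d.+1 := [tuple inord (b i) | i < n].
have FE b i : tnth (F b) i = b i :> nat.
  rewrite tnth_mktuple inordK // (leq_ltn_trans _ (bmdeg b)) //.
  by rewrite mdegE (bigD1 i) //= leq_addr.
have F_inj : injective F.
  by move=> b c eqF; apply/val_inj/mnmP => i; rewrite -!FE eqF.
rewrite -cardsT -(card_imset _ F_inj) addnC -card_partial_ord_partitions.
congr #|pred_of_set _|; apply/setP => t; rewrite inE; apply/imsetP/idP.
  case=> b _ ->; rewrite big_tuple.
  under eq_bigr do rewrite FE.
  by rewrite -mdegE -ltnS bmdeg.
rewrite big_tuple => le_td.
have lt_td : (mdeg [multinom (tnth t i : nat) | i < n] < d.+1)%N.
  by rewrite mdegE ltnS (eq_bigr _ (fun i _ => mnmE _ i)).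
exists (BMultinom lt_td) => //; apply/eq_from_tnth => i; apply/val_inj.
by rewrite /= FE /= mnmE.
Qed.

Section Interpolation.

Variables (K : fieldType) (n : nat).

Implicit Types (m : int) (p r g : {mpoly K[n]}) (E : {fset point K n}).

Lemma degree_leD m p r : degree_le m p -> degree_le m r -> degree_le m (p + r).
Proof.
case: m => d /=; last by move=> /eqP-> /eqP->; rewrite addr0.
by move=> le_p le_r; rewrite (leq_trans (msizeD_le _ _)) // geq_max le_p.
Qed.

Lemma degree_leB m p r : degree_le m p -> degree_le m r -> degree_le m (p - r).
Proof.
move=> le_p le_r; apply: degree_leD le_p _.
by case: m le_r => d /=; rewrite ?msizeN ?oppr_eq0.
Qed.

Lemma degree_leM m k r g :
  degree_le (m - k%:Z) r -> (msize g <= k.+1)%N -> degree_le m (r * g).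
Proof.
have [-> _ _|r0] := eqVneq r 0.
  by rewrite mul0r; case: m => d /=; rewrite ?msize0.
have [-> _ _|g0] := eqVneq g 0.
  by rewrite mulr0; case: m => d /=; rewrite ?msize0.
rewrite -[m in degree_le m (r * g)](subrK k%:Z).
case: (m - k%:Z) => [e|e] /=; last by rewrite (negbTE r0).
rewrite msizeM // => le_r le_g.
by have := leq_add le_r le_g; rewrite addSn addnS; case: (_ + _)%N.
Qed.

(** The hypothesis says that the evaluation matrix, with a row for each monomial
    and a column for each node, has full row space; it is square, hence
    invertible. *)
Lemma interpolates_unique m E :
  (#|` E|)%:Z = binom_e n m ->
  (forall q, exists p, interpolates m E q p) ->
  forall q, exists! p, interpolates m E q p.
Proof.
move=> cardE exE q; have [p [le_p pE]] := exE q.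
exists p; split=> // p' [le_p' p'E].
have le_h := degree_leB le_p le_p'.
have hE x : x \in E -> (p - p').@[x] = 0.
  by move=> xE; rewrite mevalB pE // p'E // subrr.
apply/eqP; rewrite -subr_eq0; move: {p p' le_p le_p' pE p'E} (p - p') le_h hE.
case: m cardE exE => d //= [cardE] exE h le_h hE.
pose N := #|{: 'X_{1..n < d.+1}}|.
pose M (i : 'I_N) : 'X_{1..n < d.+1} := enum_val i.
pose x (j : 'I_(#|` E|)) : point K n := nth [ffun=> 0] E j.
have xE j : x j \in E by rewrite mem_nth.
pose A := \matrix_(i < N, j < #|` E|) ('X_[M i] : {mpoly K[n]}).@[x j].
pose c (p : {mpoly K[n]}) := \row_(i < N) p@_(M i).
have sumE p : (msize p <= d.+1)%N -> p = \sum_(i < N) (c p) 0 i *: 'X_[M i].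
  move/mpolywE => {1}->; rewrite (reindex _ (onW_bij _ (enum_val_bij _))) /=.
  by apply: eq_bigr => i _; rewrite mxE.
have evalE p j : (msize p <= d.+1)%N -> (c p *m A) 0 j = p.@[x j].
  move=> /sumE {2}->; rewrite raddf_sum mxE /=; apply: eq_bigr => i _.
  by rewrite mevalZ !mxE.
have fullA : row_full A.
  rewrite -sub1mx; apply/row_subP => j; apply/submxP.
  (* The j-th unit vector is the value vector of an interpolant. *)
  have [p [le_p pE]] := exE (fun y => (y == x j)%:R).
  exists (c p); apply/rowP => l; rewrite evalE // pE // !mxE eq_sym.
  by rewrite nth_uniq ?fset_uniq.
have freeA : row_free A.
  have NE : N = #|` E| by rewrite cardE -card_bmultinom.
  by move: fullA; rewrite /row_full /row_free [X in _ -> _ == X]NE.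
have c0 : c h = 0.
  apply/eqP; rewrite -(mulmx_free_eq0 _ freeA); apply/eqP/rowP => j.
  by rewrite evalE // hE // mxE.
by rewrite (sumE _ le_h) c0 big1 // => i _; rewrite mxE scale0r.
Qed.

Lemma PPSN_interpolates (fs : seq {mpoly K[n]}) ks m E q :
  PPSN fs ks m E -> exists p, interpolates m E q p.
Proof.
by case: fs => [|f fs] [_ _ /(_ q)] // [p [ip _]]; exists p.
Qed.

(** An interpolant on E1 may be corrected by any multiple of g, as g vanishes
    there; the multiplier is found by interpolation on E2, where g is
    invertible. *)
Lemma interpolates_fsetU g k m E1 E2 :
  (msize g <= k.+1)%N ->
  (forall x, x \in E1 -> g.@[x] = 0) ->
  (forall x, x \in E2 -> g.@[x] != 0) ->
  (forall q, exists p, interpolates m E1 q p) ->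
  (forall q, exists r, interpolates (m - k%:Z) E2 q r) ->
  forall q, exists p, interpolates m (E1 `|` E2) q p.
Proof.
move=> le_g gE1 gE2 exE1 exE2 q.
have [p [le_p pE]] := exE1 q.
have [r [le_r rE]] := exE2 (fun x => (q x - p.@[x]) / g.@[x]).
exists (p + r * g)%R; split; first exact/degree_leD/(degree_leM le_r).
move=> x /fsetUP[] xE; rewrite mevalD mevalM.
  by rewrite gE1 // mulr0 addr0 pE.
by rewrite rE // divfK ?gE2 // addrC subrK.
Qed.

(** Lengths must agree because uniqueness is read off [fs], while the number of
    nodes is read off [ks]. *)
Lemma PPSN_fsetU (fs : seq {mpoly K[n]}) g ks k m E1 E2 :
  size fs = size ks ->
  (msize g <= k.+1)%N ->
  PPSN (rcons fs g) (rcons ks k) m E1 ->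
  PPSN fs ks (m - k%:Z) E2 ->
  (forall x, x \in E2 -> g.@[x] != 0) ->
  PPSN fs ks m (E1 `|` E2).
Proof.
move=> sz le_g P1 P2 gE2; have [card1 zero1 _] := P1; have [card2 zero2 _] := P2.
have gE1 x : x \in E1 -> g.@[x] = 0.
  by move/zero1; apply; rewrite mem_rcons mem_head.
have disj : E1 `&` E2 = fset0.
  apply/fsetP => x; rewrite !inE; apply/negP => /andP[/gE1 gx0 /gE2].
  by rewrite gx0 eqxx.
have cardU : (#|` E1 `|` E2|)%:Z = e_along n ks m.
  rewrite cardfsU disj cardfs0 subn0 PoszD card1 card2.
  by rewrite /e_along foldl_rcons /nabla subrK.
have ex := interpolates_fsetU le_g gE1 gE2
  (fun q => PPSN_interpolates q P1) (fun q => PPSN_interpolates q P2).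
split=> // [x /fsetUP[/zero1 zx f ffs|/zero2 //]|].
  by apply: zx; rewrite mem_rcons inE ffs orbT.
case: fs sz {P1 P2 zero1 zero2} => [/esym/size0nil ks0|//].
by apply: interpolates_unique => //; rewrite cardU ks0.
Qed.

End Interpolation.

Theorem theorem3p1 (R : realType) (n s : nat)
    (f : s.-tuple {mpoly R[i][n]}) (k : s.-tuple nat) (m : int)
    (E1 E2 : {fset point R[i] n}) :
  (1 <= s <= n)%N ->
  (forall j : 'I_s, hypersurface (tnth f j) (tnth k j)) ->
  (forall j : 'I_s, without_multiple_factors (tnth f j)) ->
  sufficiently_intersect f k ->
  PPSN f k m E1 ->
  PPSN (take s.-1 f) (take s.-1 k) (m - (nth 0%N k s.-1)%:Z) E2 ->
  (forall x, x \in E2 -> (nth 0 f s.-1).@[x] != 0) ->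
  PPSN (take s.-1 f) (take s.-1 k) m (E1 `|` E2).
Proof.
case: s f k => // s f k _ hyp _ _ P1 P2 fE2.
have rconsE T (z : T) (t : s.+1.-tuple T) :
    rcons (take s t) (nth z t s) = t :> seq T.
  by rewrite -take_nth ?size_tuple // take_oversize ?size_tuple.
apply: (@PPSN_fsetU _ _ _ (nth 0 f s) _ (nth 0%N k s)) => //.
- by rewrite !size_take !size_tuple.
- have /andP[_ /eqP] := hyp ord_max.
  by rewrite (tnth_nth 0) (tnth_nth 0%N) /= => ->.
- by rewrite !rconsE.
Qed.
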